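(* Let $q$ be a prime power, $n$ a non-negative integer, and let $M_q=(\mathbb{F}_q^n,\rho)$ be a nested $q$-matroid. Then $M_q$ is a transversal $q$-matroid and $M_q$ is representable.
   Context: A $q$-matroid $M=(E,\rho)$ consists of a finite-dimensional vector space $E$ over a finite field $\mathbb{F}_q$ and a function $\rho$ from the set of subspaces of $E$ to $\mathbb{Z}_{\ge 0}$ such that for all $X,Y\le E$: $0\le\rho(X)\le\dim X$; $X\le Y$ implies $\rho(X)\le\rho(Y)$; and $\rho(X+Y)+\rho(X\cap Y)\le\rho(X)+\rho(Y)$. A subspace $X$ is independent if $\rho(X)=\dim X$; it is a flat if $\rho(X)<\rho(X\oplus\langle v\rangle)$ for all $v\in E\setminus X$; it is cyclic if $\rho(H)=\rho(X)$ for every subspace $H\le X$ with $\dim H=\dim X-1$; it is a cyclic flat if it is both a flat and cyclic. A $q$-matroid is nested if its cyclic flats form a chain under inclusion. Given a finite family (repetitions allowed) $\mathcal{A}$ of $k$ subsets of a set, a finite set $X$ has an avoidance transversal of $\mathcal{A}$ if there are orderings $X=\{x_1,\dots,x_\ell\}$ and $\mathcal{A}=(A_1,\dots,A_k)$, with $\ell\le k$, such that $x_i\notin A_i$ for each $i\in[\ell]$. A $q$-matroid on $E$ is a transversal $q$-matroid if there is a finite family $\mathcal{X}=(X_1,\dots,X_k)$ of subspaces of $E$ (a presentation) such that its independent spaces are exactly the partial $q$-transversals of $\mathcal{X}$, i.e. the subspaces $X\le E$ such that every linear basis of $X$ has an avoidance transversal of $\mathcal{X}$. A $q$-matroid $(\mathbb{F}_q^n,\rho)$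 is representable if there are $m\ge 1$ and a matrix $G$ with $n$ columns over $\mathbb{F}_{q^m}$ such that $\rho(X)=\operatorname{rank}_{\mathbb{F}_{q^m}}(GA_X^{T})$ for every $X\le\mathbb{F}_q^n$, where $A_X$ is any matrix over $\mathbb{F}_q$ whose row space is $X$. *)

(* Defs.v *)
From HB Require Import structures.
From mathcomp Require Import all_boot all_order all_fingroup all_algebra all_field.

Set Implicit Arguments.
Unset Strict Implicit.
Unset Printing Implicit Defensive.

Import GRing.Theory.

Local Open Scope ring_scope.

Record qmatroid (F : finFieldType) (E : vectType F) := QMatroid {
  qrank :> {vspace E} -> nat;
  qrank_le_dim : forall X, (qrank X <= \dim X)%N;
  qrank_mono : forall X Y, (X <= Y)%VS -> (qrank X <= qrank Y)%N;
  qrank_submod : forall X Y,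
    (qrank (X + Y)%VS + qrank (X :&: Y)%VS <= qrank X + qrank Y)%N
}.

Definition qindependent (F : finFieldType) (E : vectType F) (M : qmatroid E)
  (X : {vspace E}) : Prop := M X = \dim X.

Definition qflat (F : finFieldType) (E : vectType F) (M : qmatroid E)
  (X : {vspace E}) : Prop :=
  forall v : E, v \notin X -> (M X < M (X + <[v]>)%VS)%N.

(* The zero space has no hyperplane, hence is cyclic; [(\dim H).+1] avoids
   truncated subtraction. *)
Definition qcyclic (F : finFieldType) (E : vectType F) (M : qmatroid E)
  (X : {vspace E}) : Prop :=
  forall H : {vspace E}, (H <= X)%VS -> (\dim H).+1 = \dim X -> M H = M X.

Definition qcyclic_flat (F : finFieldType) (E : vectType F) (M : qmatroid E)
  (X : {vspace E}) : Prop := qflat M X /\ qcyclic M X.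

Definition qnested (F : finFieldType) (E : vectType F) (M : qmatroid E) : Prop :=
  forall X Y : {vspace E}, qcyclic_flat M X -> qcyclic_flat M Y ->
    (X <= Y)%VS \/ (Y <= X)%VS.

(* The finite set is given by a list [X], of which only the members matter; the
   repetition-free tuple [x] is its ordering and [s] reorders the family. *)
Definition has_avoidance_transversal (T : eqType) (k : nat)
  (A : 'I_k -> {pred T}) (X : seq T) : Prop :=
  exists (l : nat) (le_lk : (l <= k)%N) (x : l.-tuple T) (s : {perm 'I_k}),
    [/\ uniq x, x =i X
      & forall i : 'I_l, tnth x i \notin A (s (widen_ord le_lk i))].

Definition partial_qtransversal (F : finFieldType) (E : vectType F) (k : nat)
  (A : 'I_k -> {vspace E}) (X : {vspace E}) : Prop :=
  forall b : seq E, basis_of X b ->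
    has_avoidance_transversal (fun i => [pred v | v \in A i]) b.

Definition qtransversal (F : finFieldType) (E : vectType F) (M : qmatroid E) :
  Prop :=
  exists (k : nat) (A : 'I_k -> {vspace E}),
    forall X : {vspace E}, qindependent M X <-> partial_qtransversal A X.

Definition row_vspace (F : fieldType) (p n : nat) (A : 'M[F]_(p, n)) :
  {vspace 'rV[F]_n} := <<[seq row i A | i : 'I_p]>>%VS.

(* With #|F| = q, a field extension [L] of [F] of degree [m] is F_{q^m}. *)
Definition qrepresentable (F : finFieldType) (n : nat)
  (M : qmatroid 'rV[F]_n) : Prop :=
  exists (m : nat) (L : fieldExtType F) (r : nat) (G : 'M[L]_(r, n)),
    [/\ (1 <= m)%N, \dim {:L} = m
      & forall (X : {vspace 'rV[F]_n}) (p : nat) (A : 'M[F]_(p, n)),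
          row_vspace A = X -> M X = \rank (G *m (map_mx (in_alg L) A)^T)].

(* Main.v *)
Require Import Defs.
From HB Require Import structures.
From mathcomp Require Import all_boot all_order all_fingroup all_algebra all_field.
From mathcomp Require Import zify.
From Stdlib Require Import Classical.

(* In any q-matroid, rho(X) is the minimum of rho(Z) + dim X - dim (X cap Z) over
   the cyclic flats Z. If these form a chain and r = rho(E), let A_j be the
   largest cyclic flat of rank at most j, for j < r, and A_r = E. Then the A_j
   increase and rho(X) = min_(j <= r) (j + dim X - dim (X cap A_j)); hence X is
   independent iff dim X <= r and dim (X cap A_j) <= j for all j < r.

   The family (A_0, ..., A_(r-1)) is a presentation: a basis of an independent
   space, sorted so that vectors lying in more of the A_j come first, avoids the
   family in order; conversely, a basis of X extending one of X cap A_j can avoid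
   the family only if dim (X cap A_j) <= j.

   For the representation, fix a basis of E adapted to the chain, and let row j
   map v to the sum of v_k t^(k (n+1)^j) over the coordinates k beyond those of
   A_j, so that row j vanishes exactly on A_j. On an independent space some
   maximal minor is a nonzero polynomial in t, of bounded degree, and t is
   specialized to an element of large degree over F. *)

Set Implicit Arguments.
Unset Strict Implicit.
Unset Printing Implicit Defensive.

Import GRing.Theory.

Local Open Scope ring_scope.

(** * Subspaces of extremal dimension and adapted bases *)

Section Vspaces.

Variables (F : fieldType) (E : vectType F).
Implicit Types (U V X : {vspace E}) (P : {vspace E} -> Prop).

Lemma ex_min_vspace P X : P X ->
  exists2 Y, P Y & forall Z, P Z -> (\dim Y <= \dim Z)%N.
Proof.
have [m] := ubnP (\dim X); elim: m X => // m IH X ltXm PX.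
have [[Z [PZ ltZX]] | minX] := classic (exists Z, P Z /\ (\dim Z < \dim X)%N).
  by apply: IH PZ; apply: leq_trans ltZX _.
by exists X => // Z PZ; rewrite leqNgt; apply/negP => ltZX; apply: minX; exists Z.
Qed.

Lemma ex_max_vspace P X : P X ->
  exists2 Y, P Y & forall Z, P Z -> (\dim Z <= \dim Y)%N.
Proof.
have [m] := ubnP (\dim {:E} - \dim X); elim: m X => // m IH X ltXm PX.
have [[Z [PZ ltXZ]] | maxX] := classic (exists Z, P Z /\ (\dim X < \dim Z)%N).
  by apply: IH PZ; have := dimvS (subvf Z); lia.
by exists X => // Z PZ; rewrite leqNgt; apply/negP => ltXZ; apply: maxX; exists Z.
Qed.

Lemma dim_add_line U v : v \notin U -> \dim (U + <[v]>) = (\dim U).+1.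
Proof.
move=> vU; have v0 : v != 0 by apply: contraNneq vU => ->; apply: mem0v.
rewrite dimv_disjoint_sum ?dim_vline ?v0 ?addn1 //.
apply/eqP; rewrite -subv0; apply/subvP => w /memv_capP[wU /vlineP[c wE]].
have [c0 | c0] := eqVneq c 0; first by rewrite wE c0 scale0r mem0v.
by case/negP: vU; rewrite -[v](scalerK c0) -wE memvZ.
Qed.

Lemma not_subv_mem U V : ~~ (U <= V)%VS -> exists2 v, v \in U & v \notin V.
Proof.
move=> UV; apply: NNPP => nex; case/negP: UV; apply/subvP => v vU.
by apply: contraT => vV; case: nex; exists v.
Qed.

(** A complement of [U :&: V] in [U] has no nonzero vector in [V], so only the part of the basis
    taken from [U :&: V] is counted. No basis of [U] has more members in [V]. *)
Lemma ex_basis_capv U V : exists2 b : seq E,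
  basis_of U b & count (mem V) b = \dim (U :&: V).
Proof.
exists (vbasis (U :\: V)%VS ++ vbasis (U :&: V)%VS).
  rewrite -{1}(addv_diff_cap U V) cat_basis ?vbasisP //.
  apply/directv_addP/eqP; rewrite -subv0 -(capv_diff U V) capvS ?subvv //.
  exact: capvSr.
rewrite count_cat; set c1 := count _ _; set c2 := count _ _.
have -> : c2 = \dim (U :&: V).
  apply/eqP; rewrite -[RHS in _ == RHS](size_tuple (vbasis (U :&: V))) -all_count.
  by apply/allP => v /vbasis_mem/memv_capP[].
suff -> : c1 = 0%N by [].
apply/eqP; rewrite -leqn0 leqNgt -has_count; apply/hasPn => v vb /=.
apply/negP => vV; have := basis_not0 (vbasisP _) vb.
by rewrite -memv0 -(capv_diff U V) memv_cap vV (vbasis_mem vb).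
Qed.

End Vspaces.

(** * Rank inequalities, cyclic flats and their chain *)

Section QMatroid.

Variables (F : finFieldType) (E : vectType F) (M : qmatroid E).
Implicit Types X Y Z : {vspace E}.

(** Submodularity for [X] and a complement of [X :&: Y] in [Y], whose rank is at most its
    dimension. *)
Lemma qrank_add_le X Y :
  (M (X + Y)%VS + \dim (X :&: Y) <= M X + \dim Y)%N.
Proof.
have subm := qrank_submod M X (Y :\: X)%VS.
have := qrank_le_dim M (Y :\: X)%VS.
have := dimv_cap_compl Y X; rewrite [(Y :&: X)%VS]capvC.
have -> : (X + Y = X + (Y :\: X))%VS by rewrite addvC -addv_diff addvC.
lia.
Qed.

Lemma qrank_cap_le X Z : (M X + \dim (X :&: Z) <= M Z + \dim X)%N.
Proof.
have := qrank_add_le Z X; rewrite capvC.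
by have := qrank_mono M (addvSr Z X); lia.
Qed.

Lemma qrank_sub_le X Y : (Y <= X)%VS -> (M X + \dim Y <= M Y + \dim X)%N.
Proof. by move=> /capv_idPr YX; have := qrank_cap_le X Y; rewrite YX. Qed.

Lemma qcyclic_flat_min X : exists2 Z, qcyclic_flat M Z &
  (M Z + \dim X <= M X + \dim (X :&: Z))%N.
Proof.
(* A minimal [Y <= X] with the nullity of [X] is cyclic, and a maximal [Z >= Y]
   with the rank of [Y] is then a cyclic flat. *)
pose P Y := (Y <= X)%VS /\ (M X + \dim Y = M Y + \dim X)%N.
have [|Y [YX eqY] minY] := @ex_min_vspace _ _ P X; first by split.
have cycY : qcyclic M Y.
  move=> H HY dimH; apply/eqP; rewrite eqn_leq qrank_mono //=.
  (* A hyperplane of smaller rank loses exactly one, hence keeps the nullity and contradicts the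
     minimality of [Y]. *)
  rewrite leqNgt; apply/negP => ltH; have := qrank_sub_le HY => leYH.
  suff /minY : P H by lia.
  by split; [apply: subv_trans HY YX | lia].
pose Q Z := (Y <= Z)%VS /\ M Z = M Y.
have [|Z [YZ eqZ] maxZ] := @ex_max_vspace _ _ Q Y; first by split.
exists Z; last first.
  by rewrite eqZ; have := dimvS (_ : Y <= X :&: Z)%VS; rewrite subv_cap YX YZ; lia.
split=> [v vZ | H HZ dimH].
  rewrite ltn_neqAle qrank_mono ?addvSl // andbT; apply/eqP => eqZv.
  suff /maxZ : Q (Z + <[v]>)%VS by rewrite dim_add_line // ltnn.
  by split; [apply: subv_trans YZ (addvSl _ _) | rewrite -eqZv].
apply/eqP; rewrite eqn_leq qrank_mono //= eqZ.
(* A hyperplane of [Z] contains [Y] or meets it in a hyperplane of [Y]; either way its rank is at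
   least [M Y]. *)
have [YH | YH] := boolP (Y <= H)%VS; first exact: qrank_mono.
have /cycY <- : (H :&: Y <= Y)%VS by apply: capvSr.
  by rewrite qrank_mono ?capvSl.
have := dimv_sum_cap H Y; have : (H + Y <= Z)%VS by rewrite subv_add HZ.
have : (\dim H < \dim (H + Y))%N.
  rewrite (ltn_leqif (dimv_leqif_sup (addvSl H Y))) subv_add subvv /=.
  exact: YH.
by move=> lt1 /dimvS; lia.
Qed.

(** No vector of [X] raises the rank of a maximal independent [Y <= X]; by submodularity none raises
    the rank of a larger subspace of [X] that has the rank of [Y], so this rank is reached up to
    [X]. *)
Lemma ex_qindependent_sub X : exists Y,
  [/\ (Y <= X)%VS, qindependent M Y & \dim Y = M X].
Proof.
pose P Y := (Y <= X)%VS /\ qindependent M Y.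
have [|Y [YX indY] maxY] := @ex_max_vspace _ _ P 0%VS.
  split; first exact: sub0v.
  by apply/eqP; rewrite eqn_leq qrank_le_dim dimv0.
exists Y; split=> //; rewrite -indY.
have addY v : v \in X -> M (Y + <[v]>)%VS = M Y.
  move=> vX; have [vY | vY] := boolP (v \in Y).
    by congr (M _); apply/addv_idPl.
  apply/eqP; rewrite eqn_leq andbC qrank_mono ?addvSl //=.
  rewrite leqNgt; apply/negP => ltY.
  suff /maxY : P (Y + <[v]>)%VS by rewrite dim_add_line // ltnn.
  split; first by rewrite subv_add YX.
  have := qrank_le_dim M (Y + <[v]>)%VS; rewrite /qindependent dim_add_line //.
  by move: ltY; rewrite indY; lia.
pose Q Z := [/\ (Y <= Z)%VS, (Z <= X)%VS & M Z = M Y].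
have [|Z [YZ ZX eqZ] maxZ] := @ex_max_vspace _ _ Q Y; first by split.
suff XZ : (X <= Z)%VS by rewrite -eqZ; congr (M _); apply/eqP; rewrite eqEsubv XZ ZX.
apply: contraT => /not_subv_mem[v vX vZ].
suff /maxZ : Q (Z + <[v]>)%VS by rewrite dim_add_line // ltnn.
split; first exact: subv_trans YZ (addvSl _ _).
  by rewrite subv_add ZX.
apply/eqP; rewrite eqn_leq andbC qrank_mono ?(subv_trans YZ (addvSl _ _)) //=.
have := qrank_submod M Z (Y + <[v]>)%VS; rewrite addY // addvA.
have -> : (Z + Y = Z)%VS by apply/addv_idPl.
have /(qrank_mono M) : (Y <= Z :&: (Y + <[v]>))%VS by rewrite subv_cap YZ addvSl.
by rewrite eqZ; lia.
Qed.

(** The last two clauses encode the minimum formula for the rank; its term at the index [M fullv] is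
    the alternative [M fullv <= M X]. *)
Lemma qnested_filtration (nestedM : qnested M) :
  exists A : 'I_(M fullv) -> {vspace E},
  [/\ {homo A : i j / (i <= j)%N >-> (i <= j)%VS},
      forall j X, (M X + \dim (X :&: A j) <= j + \dim X)%N
    & forall X, (M fullv <= M X)%N \/
        exists j : 'I_(M fullv), (j + \dim X <= M X + \dim (X :&: A j))%N].
Proof.
have exA (j : 'I_(M fullv)) : exists A, [/\ qcyclic_flat M A, (M A <= j)%N
    & forall Z, qcyclic_flat M Z -> (M Z <= j)%N -> (Z <= A)%VS].
  pose P Z := qcyclic_flat M Z /\ (M Z <= j)%N.
  (* The zero space yields a cyclic flat of rank 0, admissible for every [j]. *)
  have [Z0 cfZ0] := qcyclic_flat_min 0%VS; rewrite cap0v dimv0 => leZ0.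
  have [|A [cfA leA] maxA] := @ex_max_vspace _ _ P Z0.
    by split=> //; have := qrank_le_dim M 0%VS; rewrite dimv0; lia.
  exists A; split=> // Z cfZ leZ; have [// | AZ] := nestedM Z A cfZ cfA.
  have /eqP-> // : Z == A.
  by rewrite eq_sym eqEdim AZ maxA.
have [A AP] := fin_all_exists exA; exists A; split=> [i j leij | j X | X].
- have [cfi lei _] := AP i; have [_ _ maxj] := AP j.
  by apply: maxj => //; apply: leq_trans leij.
- by have [_ leA _] := AP j; have := qrank_cap_le X (A j); lia.
have [Z cfZ leZ] := qcyclic_flat_min X.
have [ltZ | geZ] := ltnP (M Z) (M fullv); last first.
  by left; have := dimvS (capvSl X Z); lia.
(* The minimizing [Z] lies in the member of the chain indexed by the rank of [Z]. *)
right; exists (Ordinal ltZ) => /=; have [_ _ /(_ Z cfZ (leqnn _)) ZA] := AP (Ordinal ltZ).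
by have := dimvS (capvS (subvv X) ZA); lia.
Qed.

End QMatroid.

(** * Avoidance transversals of a chain of subspaces *)

Lemma card_ord_lt (r k : nat) : (k <= r)%N -> #|[pred i : 'I_r | (i < k)%N]| = k.
Proof.
by move=> lekr; rewrite -[RHS]card_ord -!sum1_card (big_ord_widen r (fun=> 1%N)).
Qed.

Section Transversal.

Variables (F : finFieldType) (E : vectType F) (r : nat) (A : 'I_r -> {vspace E}).
Hypothesis A_homo : {homo A : i j / (i <= j)%N >-> (i <= j)%VS}.

Lemma chain_avoidance_transversal (X : {vspace E}) (b : seq E) :
    basis_of X b -> (\dim X <= r)%N ->
    (forall j, \dim (X :&: A j) <= j)%N ->
  has_avoidance_transversal (fun i => [pred v | v \in A i]) b.
Proof.
(* [h v] counts the members of the chain that miss [v]. These come first, so membership in [A j]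
   becomes [h v <= j]. *)
move=> bX leXr dimA; pose h v := #|[pred j | v \notin A j]|.
have hP v j : (v \in A j) = (h v <= j)%N.
  apply/idP/idP => [vj | ].
    rewrite -[leqRHS](card_ord_lt (ltnW (ltn_ord j))); apply: subset_leq_card.
    apply/subsetP => i; rewrite !inE ltnNge; apply: contra => leji.
    exact: subvP (A_homo leji) _ vj.
  apply: contraLR => vj; rewrite -ltnNge -[leqLHS](card_ord_lt (ltn_ord j)).
  apply: subset_leq_card; apply/subsetP => i; rewrite !inE ltnS => leij.
  by apply: contra vj; apply: (subvP (A_homo leij)).
pose leh := relpre h leq; pose x := sort leh b.
have szb : size b = \dim X.
  by rewrite -(size_basis (bX : basis_of X (in_tuple b))).
have szx : size x == \dim X by rewrite size_sort szb.
exists (\dim X), leXr, (Tuple szx), 1%g; split=> /= [|v|i].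
- by rewrite sort_uniq; apply/free_uniq/(basis_free bX).
- by rewrite mem_sort.
rewrite perm1 inE (tnth_nth 0) /=; apply/negP => xi.
have ltix : (i < size x)%N by rewrite (eqP szx).
(* By the sorting, all entries before one in [A i] are in [A i] too: i + 1 free vectors in a space
   of dimension at most i. *)
have freex : free (take i.+1 x).
  apply: (@catl_free _ _ (drop i.+1 x)); rewrite cat_take_drop.
  by rewrite (perm_free (Y := b)) ?perm_sort ?perm_refl // (basis_free bX).
have subx : (<<take i.+1 x>> <= X :&: A (widen_ord leXr i))%VS.
  apply/span_subvP => v /(nthP 0)[k]; rewrite size_takel // => ltk <-.
  have ltkx : (k < size x)%N := leq_trans ltk ltix.
  rewrite nth_take // memv_cap (basis_mem bX) /=; last first.
    by rewrite -(mem_sort leh) mem_nth.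
  move: xi; rewrite !hP; apply: leq_trans.
  apply: (@sorted_leq_nth _ leh _ _ 0 x _ k i) => //; rewrite ?inE.
  - by move=> w1 w2 w3; apply: leq_trans.
  - by move=> u; apply: leqnn.
  - by apply: sort_sorted => w1 w2; apply: leq_total.
have := dimvS subx; rewrite (eqP freex) size_takel // => /leq_trans/(_ (dimA _)).
by rewrite ltnn.
Qed.

Lemma transversal_dim_le (X : {vspace E}) :
  partial_qtransversal A X -> (\dim X <= r)%N.
Proof.
move=> /(_ _ (vbasisP X))[l [lelr [x [s [ux xE _]]]]].
apply: leq_trans lelr.
have ub := free_uniq (basis_free (vbasisP X)).
by rewrite -(size_tuple (vbasis X)) -(size_tuple x) uniq_leq_size // => v; rewrite xE.
Qed.

Lemma transversal_dim_cap_le (X : {vspace E}) (j : 'I_r) :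
  partial_qtransversal A X -> (\dim (X :&: A j) <= j)%N.
Proof.
have [b bX <-] := ex_basis_capv X (A j).
move=> /(_ b bX)[l [lelr [x [s [ux xE xA]]]]].
have ub := free_uniq (basis_free bX).
have /seq.permP-> : perm_eq b x by apply: uniq_perm => // v; rewrite xE.
rewrite -sum1_count big_tuple sum1_card.
(* Basis vectors in [A j] are sent injectively to family indices below [j], since every later member
   contains [A j]. *)
rewrite -(card_image (f := fun i => s (widen_ord lelr i))); last first.
  by move=> i k /perm_inj/(congr1 val) /= /val_inj.
rewrite -[leqRHS](card_ord_lt (ltnW (ltn_ord j))).
apply: subset_leq_card; apply/subsetP => _ /imageP[i xij ->]; rewrite !inE.
rewrite ltnNge; apply/negP => leji; have /negP[] := xA i.
by rewrite inE; apply: (subvP (A_homo leji)).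
Qed.

End Transversal.

Lemma qnested_transversal (F : finFieldType) (E : vectType F) (M : qmatroid E) :
  qnested M -> qtransversal M.
Proof.
move=> /qnested_filtration[A [A_homo A_le A_ge]].
exists (M fullv), A => X; split=> [indX b bX | trX].
  apply: (chain_avoidance_transversal A_homo bX) => [|j].
    by rewrite -indX qrank_mono ?subvf.
  by have := A_le j X; rewrite indX; lia.
apply/eqP; rewrite eqn_leq qrank_le_dim /=.
have [geX | [j geX]] := A_ge X.
  by apply: leq_trans geX; apply: transversal_dim_le trX.
by have := transversal_dim_cap_le A_homo j trX; lia.
Qed.

(** * Bases adapted to a flag *)

Section FlagBasis.

Variables (F : fieldType) (E : vectType F).

(** By induction, a basis of the last member adapted to the earlier ones is extended by a basis of a
    complement in [U]. *)
Lemma ex_flag_basis (r : nat) (A : 'I_r -> {vspace E}) (U : {vspace E}) :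
    {homo A : i j / (i <= j)%N >-> (i <= j)%VS} -> (forall j, A j <= U)%VS ->
  exists2 b : seq E, basis_of U b & forall j, A j = <<take (\dim (A j)) b>>%VS.
Proof.
elim: r A U => [|r IHr] A U A_homo AU.
  by exists (vbasis U); [apply: vbasisP | case].
have [||b bA bE] := IHr (fun j => A (widen_ord (leqnSn r) j)) (A ord_max).
- by move=> i j leij; apply: A_homo.
- by move=> j; apply: A_homo; apply: ltnW => /=.
have szb : size b = \dim (A ord_max).
  by rewrite -(size_basis (bA : basis_of _ (in_tuple b))).
exists (b ++ vbasis (U :\: A ord_max)%VS) => [|j].
  have defU : (A ord_max + (U :\: A ord_max))%VS = U.
    by rewrite addvC addv_diff; apply/addv_idPl.
  rewrite -{1}defU cat_basis ?vbasisP //.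
  by apply/directv_addP; rewrite capvC capv_diff.
rewrite takel_cat ?szb ?dimvS ?A_homo ?leq_ord //.
have [j' -> | ->] := unliftP ord_max j; last first.
  by rewrite -szb take_size (span_basis bA).
have -> : lift ord_max j' = widen_ord (leqnSn r) j'.
  by apply: ord_inj; rewrite lift_max.
exact: bE.
Qed.

Lemma mem_span_take n (b : n.-tuple E) (d : nat) v : basis_of fullv b ->
  reflect (forall k : 'I_n, (d <= k)%N -> coord b k v = 0) (v \in <<take d b>>%VS).
Proof.
move=> bE; apply: (iffP idP) => [vb k lek | v0].
  suff : (<<take d b>> <= lker (linfun (coord b k : E -> F^o)))%VS.
    by move=> /subvP/(_ v vb); rewrite memv_ker lfunE /= => /eqP.
  apply/span_subvP => w /(nthP 0)[i]; rewrite size_take_min leq_min size_tuple.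
  move=> /andP[ltid ltin] <-; rewrite memv_ker lfunE /= nth_take //.
  rewrite (coord_free (Ordinal ltin)) ?(basis_free bE) //.
  by rewrite -val_eqE /= ltn_eqF // (leq_trans ltid).
rewrite (coord_basis bE (memvf v)); apply: memv_suml => k _.
have [ledk | ltkd] := leqP d k; first by rewrite v0 // scale0r mem0v.
rewrite memvZ // memv_span // -(nth_take 0 ltkd) mem_nth // size_take_min.
by rewrite leq_min ltkd size_tuple ltn_ord.
Qed.

End FlagBasis.

(** * Nonzero minors of the polynomial matrix *)

Section PolyMatrix.

Variables (F : fieldType) (n : nat).

(** A product of one entry per row has degree at most the sum of n (n+1)^i over i < m, which is
    (n+1)^m - 1; size is degree plus one. *)
Lemma size_det_le m (P : 'M[{poly F}]_m) :
    (forall i j, size (P i j) <= n * n.+1 ^ i + 1)%N ->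
  (size (\det P) <= n.+1 ^ m)%N.
Proof.
move=> szP; apply: leq_trans (size_sum _ _ _) _; apply/bigmax_leqP => s _.
rewrite size_Msign.
apply: leq_trans (size_prod_leq _ _) _.
rewrite card_ord leq_subLR.
apply: (@leq_trans (\sum_(i < m) (n * n.+1 ^ i + 1)).+1).
  by rewrite ltnS leq_sum // => i _; apply: szP.
rewrite big_split /= sum1_card card_ord -big_distrr /=.
by rewrite -{1}[n]/(n.+1.-1) -predn_exp addnC -addnS prednK // expn_gt0.
Qed.

Variables (E : vectType F) (c : 'I_n -> {scalar E}) (a : nat -> nat).
Hypothesis c_inj : forall v, (forall k, c k v = 0) -> v = 0.

(** Exponents in row j are multiples of (n+1)^j, which exceeds the degree of every minor of the rows
    above. *)
Definition poly_row (j : nat) (v : E) : {poly F} :=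
  \sum_(k < n | (a j <= k)%N) c k v *: 'X^(k * n.+1 ^ j).

Lemma poly_row_is_linear j : linear (poly_row j).
Proof.
move=> x u v; rewrite /poly_row scaler_sumr -big_split /=; apply: eq_bigr => k _.
by rewrite linearP scalerDl scalerA.
Qed.

HB.instance Definition _ j :=
  GRing.isLinear.Build F E {poly F} _ (poly_row j) (poly_row_is_linear j).

Lemma size_poly_row_le j v p : (forall k : 'I_n, (p < k)%N -> c k v = 0) ->
  (size (poly_row j v) <= p * n.+1 ^ j + 1)%N.
Proof.
move=> v0; apply: leq_trans (size_sum _ _ _) _; apply/bigmax_leqP => k _.
have [ltpk | lekp] := ltnP p k; first by rewrite v0 // scale0r size_poly0.
apply: leq_trans (size_scale_leq _ _) _.
by rewrite size_polyXn addn1 ltnS leq_mul2r lekp orbT.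
Qed.

Lemma size_poly_row_le_n j v : (size (poly_row j v) <= n * n.+1 ^ j + 1)%N.
Proof. by apply: size_poly_row_le => k; rewrite ltnNge ltnW. Qed.

(** Distinct [k] have distinct exponents, so [c p v] is itself a coefficient. *)
Lemma size_poly_row_gt j v (p : 'I_n) : (a j <= p)%N -> c p v != 0 ->
  (p * n.+1 ^ j < size (poly_row j v))%N.
Proof.
move=> leap cp0; rewrite ltnNge; apply: contra cp0 => /leq_sizeP/(_ _ (leqnn _)).
rewrite /poly_row coef_sum (bigD1 p) //= coefZ coefXn eqxx mulr1 big1 ?addr0.
  by move=> ->.
move=> k /andP[_ kp]; rewrite coefZ coefXn eqn_mul2r expn_eq0 /=.
by rewrite val_eqE eq_sym (negPf kp) mulr0.
Qed.

(* The largest pivot [p] of [X] dominates the degrees along the last row: the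
   other vectors lie in [X] minus this pivot, and the base [n.+1] exceeds every
   pivot, so the cofactors cannot compensate. *)
Lemma ex_det_poly_row_neq0 (l : nat) (X : {vspace E}) : \dim X = l ->
    (forall (j : nat) (Y : {vspace E}), (j < l)%N -> (Y <= X)%VS ->
       (forall v (k : 'I_n), v \in Y -> (a j <= k)%N -> c k v = 0) ->
     (\dim Y <= j)%N) ->
  exists2 x : 'I_l -> E, (forall i, x i \in X) &
    \det (\matrix_(j < l, i < l) poly_row j (x i)) != 0.
Proof.
elim: l X => [|l IHl] X dimX Xa.
  by exists (fun=> 0) => [i|]; [apply: mem0v | rewrite det_mx00 oner_neq0].
pose ck k := linfun (c k : E -> F^o).
have memck k v : (v \in lker (ck k)) = (c k v == 0) by rewrite memv_ker lfunE.
have [k0 k0P] : exists k, ~~ (X <= lker (ck k))%VS.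
  apply/existsP; apply: contraPT dimX => /existsPn Xck.
  suff -> : X = 0%VS by rewrite dimv0.
  apply/eqP; rewrite -subv0; apply/subvP => v vX; rewrite memv0; apply/eqP.
  apply: c_inj => k; apply/eqP; rewrite -memck; apply: subvP vX.
  by have := Xck k; rewrite negbK.
have [p pP p_max] := @arg_maxnP _ k0 (fun k => ~~ (X <= lker (ck k))%VS)
  (fun k => k : nat) k0P.
have X0 v (k : 'I_n) : v \in X -> (p < k)%N -> c k v = 0.
  move=> vX ltpk; apply/eqP; rewrite -memck; apply: subvP v vX.
  by apply: contraLR ltpk => /p_max; rewrite -leqNgt.
have [w wX wp] := not_subv_mem pP; rewrite memck in wp.
have dimX' : \dim (X :&: lker (ck p)) = l.
  have := limg_ker_dim (ck p) X; rewrite dimX.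
  have : (\dim (ck p @: X) <= 1)%N by apply: leq_trans (dimvS (subvf _)) _; rewrite dimvf.
  have : (0 < \dim (ck p @: X))%N by rewrite lt0n dimv_eq0 -lkerE.
  lia.
have [j Y ltjl YX | x xX detx] := IHl _ dimX'.
  by apply: Xa; [apply: ltnW | apply: subv_trans YX (capvSl _ _)].
(* Otherwise all coordinates from [a l] on vanish on [X], and the hypothesis at index [l] gives
   dimension at most [l]. *)
have leap : (a l <= p)%N.
  rewrite leqNgt; apply/negP => ltpa.
  suff : (\dim X <= l)%N by rewrite dimX ltnn.
  apply: Xa => // v k vX leak.
  by apply: X0 => //; apply: leq_trans leak.
pose y i := if unlift ord_max i is Some i' then x i' else w.
exists y => [i|].
  by rewrite /y; case: unliftP => [i'|] _ //; have /memv_capP[] := xX i'.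
set P := \matrix_(_, _) _.
have Pmax i : P ord_max i = poly_row l (y i) by rewrite mxE.
rewrite (expand_det_row _ ord_max) big_ord_recr /= addrC addr_eq0.
apply/eqP => /(congr1 (size : {poly F} -> nat)); rewrite size_polyN.
set rest := \sum_(_ < _) _.
have cofactor_max : cofactor P ord_max ord_max =
    \det (\matrix_(j < l, i < l) poly_row j (x i)).
  rewrite /cofactor addnn -signr_odd odd_double mul1r; congr (\det _).
  by apply/matrixP => j i; rewrite !mxE lift_max /y liftK.
(* For p > 0 the entry has degree at most (p-1)(n+1)^l and the cofactor degree below (n+1)^l. *)
have : (size rest <= p * n.+1 ^ l)%N.
  apply: leq_trans (size_sum _ _ _) _; apply/bigmax_leqP => i _.
  rewrite Pmax; have -> : widen_ord (leqnSn l) i = lift ord_max i.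
    by apply: ord_inj; rewrite lift_max.
  rewrite /y liftK; have /memv_capP[xiX] := xX i; rewrite memck => /eqP xip.
  have xi0 (k : 'I_n) : (p.-1 < k)%N -> c k (x i) = 0.
    move=> ltpk; have [ltpk' | ltkp | /val_inj<- //] := ltngtP p k; first exact: X0.
    lia.
  (* For p = 0 the truncated [p.-1] gives no gain, but then [x i] has only zero coordinates and the
     term vanishes. *)
  have [p0 | p_gt0] := posnP p.
    rewrite /poly_row big1 ?mul0r ?size_poly0 // => k _.
    rewrite [c k _](_ : _ = 0) ?scale0r //.
    have [/val_inj<- // | lt0k] := eqVneq (p : nat) k; apply: X0 => //.
    by rewrite p0 in lt0k *; rewrite lt0n eq_sym.
  have szC : (size (cofactor P ord_max (lift ord_max i)) <= n.+1 ^ l)%N.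
    rewrite /cofactor size_Msign.
    by apply: size_det_le => i1 i2; rewrite !mxE lift_max; apply: size_poly_row_le_n.
  apply: leq_trans (size_polyMleq _ _) _; rewrite -subn1 leq_subLR.
  apply: leq_trans (leq_add (size_poly_row_le l xi0) szC) _.
  by rewrite addnAC -mulSnr prednK // addnC.
rewrite cofactor_max Pmax /y unlift_none.
have ltw := size_poly_row_gt leap wp.
have det_gt0 := detx; rewrite -size_poly_gt0 in det_gt0.
rewrite size_mul //; last by rewrite -size_poly_gt0; apply: leq_ltn_trans ltw.
move=> lerest eqrest.
suff : (p * n.+1 ^ l < size rest)%N by rewrite ltnNge lerest.
by rewrite -eqrest -(prednK det_gt0) addnS; apply: leq_trans ltw (leq_addr _ _).
Qed.

End PolyMatrix.

(* A root of [1 + 'X * Q], with [Q] the product of all nonzero polynomials of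
   size at most [D], is a root of none of them. *)
Lemma ex_elt_large_degree (F : finFieldType) (D : nat) :
  exists (L : fieldExtType F) (alpha : L), forall p : {poly F},
    p != 0 -> (size p <= D)%N -> horner_alg alpha p != 0.
Proof.
pose Q : {poly F} := \prod_(v : 'rV[F]_D | rVpoly v != 0) rVpoly v.
have Q0 : Q != 0 by apply/prodf_neq0.
have szQ : (1 < size ('X * Q + 1)%R)%N.
  rewrite mulrC size_polyDl size_mulX ?size_poly1 //;
  by rewrite ltnS size_poly_gt0.
have [|L [rs rsE _]] := @FinSplittingFieldFor F ('X * Q + 1).
  by rewrite -size_poly_gt0; apply: ltn_trans szQ.
exists L; have szrs : (1 < size (\prod_(z <- rs) ('X - z%:P))%R)%N.
  by rewrite -(eqp_size rsE) size_map_poly.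
case: rs rsE szrs => [|alpha rs] rsE; first by rewrite big_nil size_poly1.
move=> _; exists alpha => p p0 szp; apply: contraTneq isT => pa.
have : horner_alg alpha ('X * Q + 1) = 0.
  by apply/rootP; rewrite (eqp_root rsE) root_prod_XsubC mem_head.
have Qa : horner_alg alpha Q = 0.
  by rewrite rmorph_prod (bigD1 (poly_rV p)) ?poly_rV_K //= pa mul0r.
by rewrite rmorphD rmorphM /= Qa mulr0 add0r rmorph1 => /eqP; rewrite oner_eq0.
Qed.

(** * Row spaces and ranks over the extension field *)

Section RowSpace.

Variables (F : fieldType) (n : nat).

Lemma mem_row_vspace p (A : 'M[F]_(p, n)) v : (v \in row_vspace A) = (v <= A)%MS.
Proof.
apply/idP/idP => [vA | /submxP[u ->]].
  rewrite (coord_span (X := in_tuple _) vA); apply: summx_sub => i _.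
  apply: scalemx_sub; have /mapP[j _ ->] := mem_nth 0 (ltn_ord i).
  exact: row_sub.
rewrite mulmx_sum_row; apply: memv_suml => i _; rewrite memvZ // memv_span //.
by apply/mapP; exists i; rewrite ?mem_enum.
Qed.

Lemma submx_row_vspace p l (A : 'M[F]_(p, n)) (B : 'M[F]_(l, n)) :
  (forall i, row i B \in row_vspace A) -> (B <= A)%MS.
Proof. by move=> BA; apply/row_subP => i; rewrite -mem_row_vspace. Qed.

Definition vspace_mx (U : {vspace 'rV[F]_n}) : 'M[F]_(\dim U, n) :=
  \matrix_(i < \dim U) (vbasis U)`_i.

Lemma row_vspace_mx U : row_vspace (vspace_mx U) = U.
Proof.
rewrite -[RHS](span_basis (vbasisP U)); apply: eq_span => v.
apply/mapP/idP => [[i _ ->] | /(nthP 0)[i]].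
  by rewrite rowK mem_nth // size_tuple.
by rewrite size_tuple => lti <-; exists (Ordinal lti); rewrite ?mem_enum ?rowK.
Qed.

Variables (L : fieldExtType F) (r : nat) (G : 'M[L]_(r, n)).

Definition mxeval p (A : 'M[F]_(p, n)) := G *m (map_mx (in_alg L) A)^T.

Lemma rank_mxeval_sub p l (A : 'M[F]_(p, n)) (B : 'M[F]_(l, n)) :
  (B <= A)%MS -> (\rank (mxeval B) <= \rank (mxeval A))%N.
Proof.
move=> /submxP[U ->]; rewrite /mxeval map_mxM trmx_mul mulmxA.
exact: mxrankM_maxl.
Qed.

Lemma rank_mxeval_col p l (A : 'M[F]_(p, n)) (B : 'M[F]_(l, n)) :
  (\rank (mxeval (col_mx A B)) <= \rank (mxeval A) + \rank (mxeval B))%N.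
Proof.
rewrite /mxeval map_col_mx tr_col_mx mul_mx_row -mxrank_tr tr_row_mx.
rewrite -addsmxE.
by apply: leq_trans (mxrank_adds_leqif _ _) _; rewrite !mxrank_tr.
Qed.

End RowSpace.

(** * Representability *)

Lemma rank_zero_below (K : fieldType) r p (T : 'M[K]_(r, p)) (j : nat) :
  (forall (i : 'I_r) k, (j <= i)%N -> T i k = 0) -> (\rank T <= j)%N.
Proof.
move=> T0; have [lerj | ltjr] := leqP r j.
  exact: leq_trans (rank_leq_row T) lerj.
suff -> : T = pid_mx j *m T.
  apply: leq_trans (mxrankM_maxl _ _) _.
  by rewrite (@rank_pid_mx K r r) // ltnW.
apply/matrixP => i k; rewrite mxE (bigD1 i) //= mxE eqxx /= big1 ?addr0.
  by case: ltnP => [|/T0->]; rewrite ?mul1r ?mulr0.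
by move=> i' /negPf ii'; rewrite mxE -val_eqE eq_sym /= in ii' *; rewrite ii' mul0r.
Qed.

Lemma qnested_representable (F : finFieldType) (n : nat) (M : qmatroid 'rV[F]_n) :
  qnested M -> qrepresentable M.
Proof.
move=> /qnested_filtration[A [A_homo A_le A_ge]]; pose r := M fullv.
have [b0 b0E A_take] := @ex_flag_basis _ _ _ A fullv A_homo (fun j => subvf (A j)).
have szb : size b0 == n.
  rewrite -(size_basis (b0E : basis_of _ (in_tuple b0))) dimvf /=.
  by rewrite dim_matrix; apply/eqP; apply: mul1n.
pose b := Tuple szb.
have bE : basis_of fullv b by [].
pose c (k : 'I_n) : {scalar 'rV[F]_n} := coord b k.
pose a (j : nat) := if insub j is Some j' then \dim (A j') else 0%N.
have c_inj v : (forall k, c k v = 0) -> v = 0.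
  move=> v0; rewrite (coord_basis bE (memvf v)) big1 // => k _.
  by rewrite -[coord b k v]/(c k v) v0 scale0r.
have memA (j : 'I_r) v :
    reflect (forall k : 'I_n, (a j <= k)%N -> c k v = 0) (v \in A j).
  by rewrite /a valK; have := mem_span_take (\dim (A j)) v bE; rewrite /= -A_take.
(* By [size_det_le], this bounds the size of all minors of at most [r] rows. *)
have [L [alpha alphaP]] := ex_elt_large_degree F (n.+1 ^ r).
pose g := poly_row c a.
pose G : 'M[L]_(r, n) := \matrix_(j, k) horner_alg alpha (g j (delta_mx 0 k)).
have GE p (B : 'M[F]_(p, n)) j i :
    mxeval G B j i = horner_alg alpha (g j (row i B)).
  rewrite mxE [row i B]row_sum_delta /g (linear_sum (poly_row c a j)).
  rewrite rmorph_sum /=; apply: eq_bigr => k _.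
  by rewrite !mxE linearZ /= -mul_polyC rmorphM /= horner_algC mulrC.
exists (\dim {:L}), L, r, G; split=> // [|X p B BX].
  by rewrite lt0n dimv_eq0 -subv0; apply/subvPn; exists 1;
     rewrite ?memvf ?memv0 ?oner_eq0.
rewrite -[_ *m _]/(mxeval G B); apply/eqP; rewrite eqn_leq; apply/andP; split; last first.
  have [geX | [j geX]] := A_ge X; first exact: leq_trans (rank_leq_row _) geX.
  (* On [X :&: A j] only the rows before [j] survive, giving rank at most [j]; a complement adds at
     most its dimension. *)
  pose B1 := vspace_mx (X :&: A j); pose B2 := vspace_mx (X :\: A j).
  have /(rank_mxeval_sub G) : (B <= col_mx B1 B2)%MS.
    apply/row_subP => i; rewrite -addsmxE.
    have : row i B \in X by rewrite -BX mem_row_vspace row_sub.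
    rewrite -{1}(addv_diff_cap X (A j)) addvC => /memv_addP[u uX [w wX ->]].
    by rewrite addmx_sub_adds // -mem_row_vspace row_vspace_mx.
  move=> /leq_trans-> //; apply: leq_trans (rank_mxeval_col _ _ _) _.
  have rk1 : (\rank (mxeval G B1) <= j)%N.
    apply: rank_zero_below => i k leji; rewrite GE.
    have /memv_capP[_ uA] : row k B1 \in (X :&: A j)%VS.
      by rewrite -{2}(row_vspace_mx (X :&: A j)) mem_row_vspace row_sub.
    have /memA ui : row k B1 \in A i by apply: (subvP (A_homo _ _ leji)).
    by rewrite /g /poly_row big1 ?rmorph0 // => k' leak; rewrite ui // scale0r.
  apply: leq_trans (leq_add rk1 (rank_leq_col _)) _.
  rewrite -(leq_add2r (\dim (X :&: A j))) -addnA.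
  by rewrite [(\dim (_ :\: _) + _)%N]addnC dimv_cap_compl.
have [Y [YX indY dimY]] := ex_qindependent_sub M X.
have leYr : (\dim Y <= r)%N by rewrite dimY qrank_mono ?subvf.
(* Independence of [Y] is what the minor requires: a [Z] killed beyond [a j] lies in [Y :&: A j], of
   dimension at most [j]. *)
have [j Z ltjY ZY Z0 | x xY detx] := ex_det_poly_row_neq0 c_inj (a := a) (erefl (\dim Y)).
  have ltjr : (j < r)%N := leq_trans ltjY leYr.
  have := A_le (Ordinal ltjr) Y; rewrite indY addnC leq_add2r /= => dimYA.
  have ZA : (Z <= Y :&: A (Ordinal ltjr))%VS.
    rewrite subv_cap ZY; apply/subvP => v vZ; apply/memA => k leak.
    exact: Z0 leak.
  exact: leq_trans (dimvS ZA) dimYA.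
pose BY : 'M[F]_(\dim Y, n) := \matrix_i x i.
have BYB : (BY <= B)%MS.
  by apply: submx_row_vspace => i; rewrite rowK BX (subvP YX).
rewrite -dimY; apply: leq_trans (rank_mxeval_sub G BYB).
set P := \matrix_(_, _) _ in detx.
have PE : map_mx (horner_alg alpha) P = rowsub (widen_ord leYr) (mxeval G BY).
  apply/matrixP => j i; rewrite [RHS]mxE GE rowK.
  by rewrite 2!mxE.
have rkP : \rank (map_mx (horner_alg alpha) P) = \dim Y.
  apply: mxrank_unit; rewrite unitmxE det_map_mx unitfE; apply: alphaP => //.
  apply: (@leq_trans (n.+1 ^ \dim Y)); last by rewrite leq_pexp2l.
  by apply: size_det_le => i j; rewrite mxE size_poly_row_le_n.
rewrite -[leqLHS]rkP PE; apply: mxrankS.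
by apply/row_subP => i; rewrite row_rowsub row_sub.
Qed.

Theorem corollary3p16 (F : finFieldType) (n : nat) (M : qmatroid 'rV[F]_n)
  (nestedM : qnested M) : qtransversal M /\ qrepresentable M.
Proof.
by split; [apply: qnested_transversal | apply: qnested_representable].
Qed.
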